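(* Let $X$ be an abelian variety over a field $K$ of characteristic different from $2$, and let $G=\bar\rho_{2,X}(\mathrm{Gal}(K))\subset\mathrm{Aut}_{\mathbb F_2}(X_2)$. Assume: (a) $\dim X=2$; (b) $G\cong\mathbb A_5$; (c) $X_2$ is a simple $G$-module; (d) $\mathrm{End}_G(X_2)\cong\mathbb F_4$. Identify $\mathbb F_2$ with $\mathbb F_2\cdot\mathrm{Id}_{X_2}$ and $\mathbb F_4$ with $\mathrm{End}_G(X_2)$. Let $R$ be an $\mathbb F_2$-subalgebra of $\mathrm{End}_{\mathbb F_2}(X_2)$ containing $\mathrm{Id}_{X_2}$ such that $uRu^{-1}\subset R$ for all $u\in G$. Then $R$ equals one of: $\mathbb F_2$; $\mathbb F_4$; $\mathrm{End}_{\mathbb F_4}(X_2)$; $\mathrm{End}_{\mathbb F_2}(X_2)$.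
   Context: $X_2$ is the $4$-dimensional $\mathbb F_2$-vector space of points of order dividing $2$ of $X$ over an algebraic closure of $K$, and $\bar\rho_{2,X}:\mathrm{Gal}(K)\to\mathrm{Aut}_{\mathbb F_2}(X_2)$ is the Galois action. $X_2$ is regarded as an $\mathbb F_4$-vector space via $\mathrm{End}_G(X_2)\cong\mathbb F_4$. *)

(* Defs.v *)
From HB Require Import structures.
From mathcomp Require Import all_boot all_order all_algebra all_fingroup all_solvable all_field all_character.
Set Implicit Arguments. Unset Strict Implicit. Unset Printing Implicit Defensive.
Import GRing.Theory.
Local Open Scope ring_scope.

(* X_2 is modelled as the row space 'rV['F_2]_4; Aut_{F_2}(X_2) as {'GL_4['F_2]},
   End_{F_2}(X_2) as 'M['F_2]_4 (matrices acting on row vectors). *)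
Notation F2 := ('F_2).
Notation Mat := ('M[F2]_4).

Lemma GL_mx_repr (G : {group {'GL_4[F2]}}) :
  mx_repr G (fun g : {'GL_4[F2]} => GLval g).
Proof. by split=> // x y _ _. Qed.

Definition GLrep (G : {group {'GL_4[F2]}}) : mx_representation F2 G 4 :=
  MxRepresentation (GL_mx_repr G).

Definition EndG (G : {group {'GL_4[F2]}}) : {set Mat} :=
  [set A : Mat | centgmx (GLrep G) A].

(* "End_G(X_2) is isomorphic to F_4": End_G(X_2) = F_2[J] with J^2 + J + 1 = 0,
   i.e. it is the field F_2[x]/(x^2+x+1) = F_4 realised inside End(X_2). *)
Definition EndG_is_F4 (G : {group {'GL_4[F2]}}) : Prop :=
  exists J : Mat, J ^+ 2 + J + 1 = 0 /\
    EndG G = [set a%:M + b *: J | a : F2, b : F2].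

Definition scalarsF2 : {set Mat} := [set a%:M | a : F2].

Definition EndF4 (G : {group {'GL_4[F2]}}) : {set Mat} :=
  [set A : Mat | [forall B in EndG G, A *m B == B *m A]].

Definition F2_subalgebra (R : {set Mat}) : Prop :=
  [/\ 1%:M \in R,
      {in R &, forall x y, x + y \in R},
      {in R &, forall x y, x *m y \in R} &
      forall (a : F2), {in R, forall x, a *: x \in R}].

(* Main.v *)
Require Import Defs.
From HB Require Import structures.
From mathcomp Require Import all_boot all_order all_algebra all_fingroup all_solvable all_field all_character.
Import GRing.Theory.
Local Open Scope ring_scope.

(** A G-stable subalgebra S with at most 16 elements is centralised by G: an
    element of order 5 must fix S pointwise, and G is simple. So S is contained
    in EndG G = F_4 and equals F_2 or F_4.

    If V = 'rV_4 is a simple R-module, the centralizer of R is G-stable and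
    embeds into V (Schur), hence is F_2 or F_4; by the density theorem R is its
    own bicentralizer, i.e. End_{F_2}(V) or End_{F_4}(V).

    Otherwise let W be a minimal R-submodule. As G is irreducible some translate
    Wu differs from W, and then W meets Wu trivially, so W has 2 or 4 elements.
    If #|W| = 2, R is diagonal in a basis of translates of W, so #|R| <= 16. If
    #|W| = 4 and R is faithful on W, then #|R| <= 16 as R embeds into End(W). If
    R is not faithful on W, then W and Wu are the only G-translates of W, and
    the simple group G would have a subgroup of index 2. *)

(** * Submodules, centralizers and annihilators *)

(** Boolean-valued, so that [minset] can select minimal submodules. *)
Definition submodule {F : finFieldType} {n : nat} (R : {set 'M[F]_n})
    (S : {set 'rV[F]_n}) : bool :=
  [&& 0 \in S,
      [forall a : F, forall u in S, forall v in S, a *: u + v \in S] &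
      [forall v in S, forall r in R, v *m r \in S]].

Definition subalgebra {F : finFieldType} {n : nat} (R : {set 'M[F]_n}) : Prop :=
  [/\ 1%:M \in R, submod_closed R & {in R &, forall x y, x *m y \in R}].

Definition irreducible_algebra {F : finFieldType} {n : nat}
    (R : {set 'M[F]_n}) : Prop :=
  forall S, submodule R S -> S = [set 0] \/ S = setT.

Definition centralizer {F : finFieldType} {n : nat} (R : {set 'M[F]_n}) :
    {set 'M[F]_n} := [set A : 'M[F]_n | [forall B in R, A *m B == B *m A]].

(** The vectors form a list because the density argument is an induction on it. *)
Definition annihilator {F : finFieldType} {n : nat} (R : {set 'M[F]_n})
    (vs : seq 'rV[F]_n) : {set 'M[F]_n} :=
  [set r in R | all (fun v => v *m r == 0) vs].

Lemma submoduleP {F : finFieldType} {n : nat} (R : {set 'M[F]_n})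
    (S : {set 'rV[F]_n}) :
  reflect (submod_closed S /\ {in S & R, forall v r, v *m r \in S})
          (submodule R S).
Proof.
apply: (iffP and3P) => [[S0 /forallP lS /forall_inP sS] | [[S0 lS] sS]].
  split; first split=> // a u v uS vS.
    by have /forall_inP/(_ _ uS)/forall_inP := lS a; apply.
  by move=> v r vS rR; have /forall_inP := sS v vS; apply.
split=> //.
  by apply/forallP=> a; apply/forall_inP=> u uS; apply/forall_inP=> v; apply: lS.
by apply/forall_inP=> v vS; apply/forall_inP=> r; apply: sS.
Qed.

Lemma submod_closed_add {F : finFieldType} {V : lmodType F} {S : {pred V}} :
  submod_closed S -> {in S &, forall u v, u + v \in S}.
Proof. by move=> [_ lS] u v uS vS; rewrite -[u]scale1r lS. Qed.

Lemma submod_closed_scale {F : finFieldType} {V : lmodType F} {S : {pred V}} :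
  submod_closed S -> forall a, {in S, forall u, a *: u \in S}.
Proof. by move=> [S0 lS] a u uS; rewrite -[_ *: _]addr0 lS. Qed.

Lemma submod_closed_sub {F : finFieldType} {V : lmodType F} {S : {pred V}} :
  submod_closed S -> {in S &, forall u v, u - v \in S}.
Proof. by move=> /GRing.submod_closedB []. Qed.

Lemma submod_closed_sum {F : finFieldType} {V : lmodType F} {S : {pred V}}
    {I : finType} {P : pred I} {E : I -> V} :
  submod_closed S -> (forall i, P i -> E i \in S) -> \sum_(i | P i) E i \in S.
Proof.
move=> cS ES; apply: (big_ind (fun x => x \in S)) => //; first by case: cS.
exact: submod_closed_add.
Qed.

Lemma centralizerP {F : finFieldType} {n : nat} (R : {set 'M[F]_n}) A :
  reflect {in R, forall B, A *m B = B *m A} (A \in centralizer R).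
Proof.
rewrite inE; apply: (iffP forall_inP) => cA B /cA; first by move/eqP.
by move->.
Qed.

Lemma centralizer_subalgebra {F : finFieldType} {n : nat} (R : {set 'M[F]_n}) :
  subalgebra (centralizer R).
Proof.
split; first by apply/centralizerP=> B _; rewrite mul1mx mulmx1.
  split=> [|a A B /centralizerP cA /centralizerP cB].
    by apply/centralizerP=> B _; rewrite mul0mx mulmx0.
  apply/centralizerP=> D RD.
  by rewrite mulmxDl mulmxDr -scalemxAl -scalemxAr cA ?cB.
move=> A B /centralizerP cA /centralizerP cB; apply/centralizerP=> D RD.
by rewrite -mulmxA cB // mulmxA cA // mulmxA.
Qed.

Lemma annihilatorP {F : finFieldType} {n : nat} (R : {set 'M[F]_n}) vs r :
  reflect (r \in R /\ {in vs, forall v, v *m r = 0}) (r \in annihilator R vs).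
Proof.
rewrite inE; apply: (iffP andP) => [[-> /allP h] | [-> h]]; split=> //.
  by move=> v /h/eqP.
by apply/allP=> v /h/eqP.
Qed.

Lemma annihilator_submod {F : finFieldType} {n : nat} {R : {set 'M[F]_n}} vs :
  subalgebra R -> submod_closed (annihilator R vs).
Proof.
move=> [_ [R0 lR] _]; split=> [|a r s].
  by apply/annihilatorP; split=> // v _; rewrite mulmx0.
move=> /annihilatorP[rR r0] /annihilatorP[sR s0].
apply/annihilatorP; split=> [|v vvs]; first exact: lR.
by rewrite mulmxDr -scalemxAr r0 // s0 // scaler0 addr0.
Qed.

Lemma annihilator_ideal {F : finFieldType} {n : nat} {R : {set 'M[F]_n}} vs :
  subalgebra R ->
  {in annihilator R vs & R, forall a r : 'M[F]_n, a *m r \in annihilator R vs}.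
Proof.
move=> [_ _ mR] a r /annihilatorP[aR a0] rR.
apply/annihilatorP; split=> [|v vvs]; first exact: mR.
by rewrite mulmxA a0 // mul0mx.
Qed.

(** * Jacobson density and the double centralizer *)

(** Source of the submodules to which irreducibility of [R] is applied: with [A] an annihilator,
    [v A] must be zero or the whole space. *)
Lemma image_submodule {F : finFieldType} {n : nat} {R A : {set 'M[F]_n}} (v : 'rV_n) :
  submod_closed A -> {in A & R, forall a r : 'M[F]_n, a *m r \in A} ->
  submodule R [set v *m a | a in A].
Proof.
move=> [A0 lA] iA; apply/submoduleP; split; first split.
- by apply/imsetP; exists 0; rewrite ?mulmx0.
- move=> k _ _ /imsetP[a aA ->] /imsetP[b bA ->].
  apply/imsetP; exists (k *: a + b); first exact: lA.
  by rewrite mulmxDr -scalemxAr.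
move=> _ r /imsetP[a aA ->] rR.
by apply/imsetP; exists (a *m r); rewrite ?iA ?mulmxA.
Qed.

(* Jacobson's induction: if [v] is killed by the annihilator of [v1 :: vs], then
   [v1 a |-> v a], for [a] killing [vs], is an element [phi] of the centralizer,
   and [v - v1 phi] is killed by the annihilator of [vs]. *)
Lemma bicentralizer_agree {F : finFieldType} {n : nat} {R : {set 'M[F]_n}} :
  subalgebra R -> irreducible_algebra R ->
  forall (vs : seq 'rV_n) (v : 'rV_n), {in annihilator R vs, forall a, v *m a = 0} ->
  forall x r, x \in centralizer (centralizer R) -> r \in R ->
    {in vs, forall w, w *m x = w *m r} -> v *m x = v *m r.
Proof.
move=> aR irrR; elim=> [|v1 vs IH] v v0 x r xCC rR exr.
  have -> : v = 0; last by rewrite !mul0mx.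
  rewrite -[v]mulmx1 v0 //; apply/annihilatorP; split=> //; by case: aR.
have lA := annihilator_submod vs aR.
have iA := annihilator_ideal vs aR.
have exr' : {in vs, forall w, w *m x = w *m r}.
  by move=> w wvs; rewrite exr // inE wvs orbT.
have annS a : a \in annihilator R vs -> v1 *m a = 0 -> v *m a = 0.
  move=> /annihilatorP[a_R a0] v1a; apply: v0; apply/annihilatorP; split=> // w.
  by rewrite inE => /predU1P[->|/a0].
(* If the annihilator of [vs] kills [v1], then it also kills [v], and the induction hypothesis
   applies to [v] directly. Otherwise it moves [v1] onto the whole space. *)
have [v1A | v1A] := irrR _ (image_submodule v1 lA iA).
  apply: IH => // a aA; apply: annS => //.
  by apply/set1P; rewrite -v1A; apply: imset_f.
have /fin_all_exists2[a aA v1a] (i : 'I_n) :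
    exists2 a, a \in annihilator R vs & v1 *m a = delta_mx 0 i.
  have: delta_mx 0 i \in [set v1 *m a | a in annihilator R vs].
    by rewrite v1A inE.
  by case/imsetP=> a aA ->; exists a.
pose phi := \matrix_i (v *m a i).
have phiE b : b \in annihilator R vs -> v1 *m b *m phi = v *m b.
  move=> bA; pose c := \sum_i (v1 *m b) 0 i *: a i.
  have cA : c \in annihilator R vs.
    by apply: submod_closed_sum => // i _; apply: submod_closed_scale.
  have -> : v1 *m b *m phi = v *m c.
    rewrite mulmx_sum_row mulmx_sumr; apply: eq_bigr => i _.
    by rewrite rowK scalemxAr.
  (* [phi] is well defined: [c - b] kills [vs] and [v1], hence [v]. *)
  apply/eqP; rewrite -subr_eq0 -mulmxBr; apply/eqP/annS.
    exact: submod_closed_sub.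
  rewrite mulmxBr [v1 *m b]row_sum_delta mulmx_sumr -sumrB big1 // => i _.
  by rewrite -scalemxAr v1a subrr.
have phiC : phi \in centralizer R.
  apply/centralizerP=> s sR; apply/row_matrixP=> i.
  rewrite !row_mul rowK rowE -v1a -!mulmxA -phiE; last exact: iA.
  by rewrite !mulmxA.
have xphi : x *m phi = phi *m x by move/centralizerP: xCC => ->.
have rphi : phi *m r = r *m phi by move/centralizerP: phiC => ->.
have v1x : v1 *m x = v1 *m r by rewrite exr // mem_head.
have : (v - v1 *m phi) *m x = (v - v1 *m phi) *m r.
  apply: IH => // b bA; rewrite mulmxBl -mulmxA.
  move/centralizerP: (phiC) => ->; last by case/annihilatorP: bA.
  by rewrite mulmxA phiE // subrr.
rewrite !mulmxBl -!mulmxA -xphi rphi !mulmxA v1x; exact: addIr.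
Qed.

(** An element of the bicentralizer agrees with some element of [R] on any finite list of vectors,
    by induction on the list; the standard basis then gives equality. *)
Theorem bicentralizer_irreducible {F : finFieldType} {n : nat} {R : {set 'M[F]_n}} :
  subalgebra R -> irreducible_algebra R -> centralizer (centralizer R) = R.
Proof.
move=> aR irrR; apply/setP=> x; apply/idP/idP; last first.
  move=> xR; apply/centralizerP=> c /centralizerP cC; by rewrite cC.
move=> xCC.
have agree (vs : seq 'rV[F]_n) : exists2 r, r \in R & {in vs, forall w, w *m x = w *m r}.
  elim: vs => [|v vs [r rR xr]]; first by case: aR => R1 _ _; exists 1%:M.
  have lA := annihilator_submod vs aR.
  have [vA | vA] := irrR _ (image_submodule v lA (annihilator_ideal vs aR)).
    exists r => // w; rewrite inE => /predU1P[->|/xr //].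
    apply: (bicentralizer_agree aR irrR vs) => // a aA.
    by apply/set1P; rewrite -vA; apply: imset_f.
  have: v *m x - v *m r \in [set v *m a | a in annihilator R vs] by rewrite vA inE.
  move=> /imsetP[a /annihilatorP[a_R a0] va].
  exists (r + a); first by case: aR => _ lR _; apply: (submod_closed_add lR).
  move=> w; rewrite inE mulmxDr => /predU1P[->|wvs].
    by rewrite -va addrC subrK.
  by rewrite a0 // addr0 xr.
have [r rR xr] := agree [seq delta_mx 0 i | i : 'I_n].
suff -> : x = r by [].
apply/row_matrixP=> i; rewrite !rowE; apply: xr.
by apply/imageP; exists i.
Qed.

(** * Cardinalities of subspaces *)

(** Lagrange's theorem in the additive group of matrices. *)
Lemma card_submod_dvd {F : finFieldType} {m n : nat} (S : {set 'M[F]_(m, n)}) :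
  submod_closed S -> (#|S| %| #|F| ^ (m * n))%N.
Proof.
move=> cS; have gS : group_set S.
  by apply/group_setP; split=> [|x y]; [case: cS | apply: submod_closed_add].
have := @cardSg _ [set: 'M[F]_(m, n)]%G (group gS) (subsetT _).
by rewrite cardsT card_mx.
Qed.

Lemma card_submod_F2 {m n : nat} (S : {set 'M['F_2]_(m, n)}) :
  submod_closed S -> exists k, #|S| = (2 ^ k)%N.
Proof.
move/card_submod_dvd; rewrite card_Fp // => /(dvdn_pfactor _ _ (isT : prime 2))[k _ ->].
by exists k.
Qed.

Lemma submod_closed_F2 {m n : nat} (S : {pred 'M['F_2]_(m, n)}) :
  0 \in S -> {in S &, forall x y, x + y \in S} -> submod_closed S.
Proof.
move=> S0 aS; split=> // a x y xS yS; apply: (aS) => //.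
case: a => [[|[|//]] lt2].
  by rewrite (_ : Ordinal _ = 0) ?scale0r //; apply: val_inj.
by rewrite (_ : Ordinal _ = 1) ?scale1r //; apply: val_inj.
Qed.

(** * Simple groups acting on small spaces over F_2 *)

Lemma simple_normal_eq {gT : finGroupType} (G H : {group gT}) :
  simple G -> (H <| G)%g -> H :!=: 1%g -> H :=: G.
Proof. by move=> /simpleP[_ sG] /sG[->|->] //; rewrite eqxx. Qed.

Lemma Alt5_simple_card {gT : finGroupType} (G : {group gT}) :
  G \isog ('Alt_('I_5))%G -> simple G /\ #|G| = 60.
Proof.
move=> isoG; split; first by rewrite (isog_simple isoG) simple_Alt5 ?card_ord.
have := @card_Alt 'I_5; rewrite (card_isog isoG) card_ord => /(_ isT).
(* [card_Alt] gives twice the order as [5!], so both sides are halved. *)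
by move/(congr1 half); rewrite mul2n doubleK => ->.
Qed.

(* An element [g] of order 5 has a number of fixed points on [S] that is a power
   of 2, is at least 2 and is congruent to [#|S|] modulo 5; as [#|S| <= 16] it
   fixes all of [S], and the kernel of the action is normal. *)
Lemma small_space_fixed {gT : finGroupType} {G : {group gT}} {m n : nat}
    {to : {action gT &-> 'M['F_2]_(m, n)}} {S : {set 'M['F_2]_(m, n)}} :
    simple G -> (5 %| #|G|)%N ->
    (forall a, {morph to^~ a : x y / x + y}) ->
    submod_closed S -> [acts G, on S | to] ->
    (exists2 x, x \in 'Fix_(S | to)(G)%g & x != 0) -> (#|S| <= 16)%N ->
  S \subset 'Fix_to(G)%g.
Proof.
move=> simG dvd5 toD cS actS [x0 /setIP[x0S /afixP x0F] x0n0] S16.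
have [g gG og] := Cauchy (isT : prime 5) dvd5.
have sgG : (<[g]> \subset G)%g by rewrite cycle_subG.
have pg : (5.-group <[g]>)%g by rewrite /pgroup -orderE og pnat_id.
pose T := 'Fix_(S | to)(<[g]>)%g.
have to0 a : to 0 a = 0.
  by apply: (@addrI _ (to 0 a)); rewrite -toD !addr0.
have cT : submod_closed T.
  apply: submod_closed_F2.
    by rewrite inE; case: cS => -> _; apply/afixP.
  move=> x y /setIP[xS /afixP xF] /setIP[yS /afixP yF].
  rewrite inE (submod_closed_add cS) //; apply/afixP=> a aG.
  by rewrite toD xF ?yF.
have STmod := pgroup_fix_mod pg (subset_trans sgG actS).
have TS : (#|T| <= #|S|)%N by apply/subset_leq_card/subsetIl.
have T2 : (1 < #|T|)%N.
  have sub : [set 0; x0] \subset T.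
    apply/subsetP=> x /set2P[]->; first by case: cT.
    by rewrite inE x0S; apply/afixP=> a /(subsetP sgG)/x0F.
  by have := subset_leq_card sub; rewrite cards2 eq_sym x0n0.
have eqTS : #|T| = #|S|.
  (* The order of 2 modulo 5 is 4, so congruent powers [2 ^ i] and [2 ^ j] with [1 <= j <= i <= 4]
     are equal. The fixed vector [x0] excludes [j = 0], where 16 and 1 would be congruent. *)
  move: STmod TS T2 S16; rewrite -/T.
  have [i ->] := card_submod_F2 _ cS; have [j ->] := card_submod_F2 _ cT.
  move=> ij jle j1 i16.
  have i4 : (i <= 4)%N by rewrite -(leq_exp2l (m := 2)).
  have jlei : (j <= i)%N by rewrite -(leq_exp2l (m := 2)).
  move: j1 ij jlei i4 {jle i16}.
  by case: i => [|[|[|[|[|i]]]]] //; case: j => [|[|[|[|[|j]]]]].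
have STeq : T = S.
  by apply/eqP; rewrite eqEcard eqTS leqnn subsetIl.
pose H := 'C_G(S | to)%G.
have gH : g \in H.
  rewrite !inE gG /=; apply/subsetP=> x; rewrite -STeq => /setIP[_ /afixP xF].
  by rewrite inE xF ?cycle_id.
have nH : (H <| G)%g.
  rewrite /normal subsetIl normsI ?normG //.
  exact: subset_trans actS (astab_norm _ _).
have HG : H :=: G.
  apply: simple_normal_eq => //; apply/trivgPn; exists g => //.
  by rewrite -order_eq1 og.
apply/subsetP=> x xS; apply/afixP=> a; rewrite -HG => /setIP[_ /astabP]; exact.
Qed.

(** * Irreducible representations *)

(** Passage from sets of vectors to row spaces: the span [U] of [S] has all its vectors in [S], so
    [U] is a submodule and matrix irreducibility applies to it. *)
Lemma irreducible_stable_set {F : finFieldType} {gT : finGroupType}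
    {G : {group gT}} {n : nat} {rG : mx_representation F G n} {S : {set 'rV[F]_n}} :
    mx_irreducible rG -> submod_closed S ->
    {in S & G, forall v u, v *m rG u \in S} ->
  S = [set 0] \/ S = setT.
Proof.
move=> /mx_irrP[_ irr] cS sS; pose U := (\sum_(v in S) <<v>>)%MS.
have inU v : v \in S -> (v <= U)%MS.
  by move=> vS; rewrite (sumsmx_sup v) // genmxE.
have Uin v : (v <= U)%MS -> v \in S.
  move=> /sub_sumsmxP[c ->]; apply: submod_closed_sum => // w wS.
  have: (c w *m <<w>>%MS <= w)%MS by rewrite (submx_trans (submxMl _ _)) ?genmxE.
  by move=> /sub_rVP[a ->]; apply: submod_closed_scale.
have [U0|U0] := eqVneq U 0.
  left; apply/setP=> v; rewrite inE; apply/idP/eqP=> [/inU|->]; last by case: cS.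
  by rewrite U0 submx0 => /eqP.
right; apply/setP=> v; rewrite inE; apply: (Uin); apply: submx_full.
apply: irr => //; apply/mxmoduleP=> u uG; apply/rV_subP=> w /submxP[y ->].
rewrite mulmxA; apply: inU; apply: sS => //; apply: Uin; exact: submxMl.
Qed.

(** The cyclic module of [w] is the whole space, so the translates of [w] span; a full-rank
    selection of rows extracts a basis from them. *)
Lemma irreducible_orbit_basis {F : fieldType} {gT : finGroupType}
    {G : {group gT}} {n : nat} {rG : mx_representation F G n} {w : 'rV[F]_n} :
    mx_irreducible rG -> w != 0 ->
  exists2 f : 'I_n -> gT, forall i, f i \in G & \matrix_i (w *m rG (f i)) \in unitmx.
Proof.
move=> /mx_irrP[_ irr] w0.
have fullw : row_full (enveloping_algebra_mx rG *m lin_mul_row w).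
  have : row_full (cyclic_mx rG w).
    apply: irr; first exact: cyclic_mx_module.
    apply: contraNneq w0 => c0; rewrite -submx0 -c0; exact: cyclic_mx_id.
  by rewrite -!sub1mx genmxE.
exists (fun i => enum_val (fullrankfun fullw i)) => [i|]; first exact: enum_valP.
have -> : \matrix_i (w *m rG (enum_val (fullrankfun fullw i))) =
          rowsub (fullrankfun fullw) (enveloping_algebra_mx rG *m lin_mul_row w).
  apply/row_matrixP=> i; rewrite rowK row_rowsub row_mul rowK mul_vec_lin_row //.
exact: fullrowsub_unit.
Qed.

(* [GLval] with its type ['M_4.-1.+1] and its ring structure normalised, so that
   matrix lemmas rewrite under it. *)
Definition glmx (u : {'GL_4['F_2]}) : 'M['F_2]_4 := GLval u.

Lemma glmx1 : glmx 1%g = 1%:M.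
Proof. by []. Qed.

Lemma glmxM u v : glmx (u * v)%g = glmx u *m glmx v.
Proof. by []. Qed.

Lemma glmx_mulV u : glmx u *m glmx u^-1%g = 1%:M.
Proof. by rewrite -glmxM mulgV. Qed.

Lemma glmx_mulVx u : glmx u^-1%g *m glmx u = 1%:M.
Proof. by rewrite -glmxM mulVg. Qed.

(** * Actions of GL_4(F_2) on row vectors and, by conjugation, on matrices *)

Lemma row_act1 : (fun (v : 'rV['F_2]_4) (u : {'GL_4['F_2]}) => v *m glmx u)^~ 1%g =1 id.
Proof. by move=> v; rewrite glmx1 mulmx1. Qed.

Lemma row_actM (v : 'rV['F_2]_4) :
  act_morph (fun v (u : {'GL_4['F_2]}) => v *m glmx u) v.
Proof. by move=> a b; rewrite glmxM mulmxA. Qed.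

Definition row_action : {action {'GL_4['F_2]} &-> 'rV['F_2]_4} :=
  TotalAction row_act1 row_actM.

(** This order of the factors gives a right action. The main hypothesis conjugates the other way
    round and is therefore applied to [u^-1]. *)
Definition conj_mx (A : 'M['F_2]_4) (u : {'GL_4['F_2]}) : 'M['F_2]_4 :=
  glmx u^-1%g *m A *m glmx u.

Lemma conj_mx1 : conj_mx^~ 1%g =1 id.
Proof. by move=> A; rewrite /conj_mx invg1 glmx1 mulmx1 mul1mx. Qed.

Lemma conj_mxM A : act_morph conj_mx A.
Proof. by move=> a b; rewrite /conj_mx invMg !glmxM !mulmxA. Qed.

Definition conj_action : {action {'GL_4['F_2]} &-> 'M['F_2]_4} :=
  TotalAction conj_mx1 conj_mxM.

Definition conj_stable (G : {group {'GL_4['F_2]}}) (S : {set 'M['F_2]_4}) : Prop :=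
  {in S & G, forall r u, conj_mx r u \in S}.

Lemma EndGP (G : {group {'GL_4['F_2]}}) A :
  reflect {in G, forall u, A *m glmx u = glmx u *m A} (A \in EndG G).
Proof. by rewrite in_set; apply: (iffP (@centgmxP _ _ G 4 (GLrep G) A)) => h u /h. Qed.

Lemma conj_mx_fix A u : conj_mx A u = A -> A *m glmx u = glmx u *m A.
Proof.
by move=> e; rewrite -[in RHS]e /conj_mx !mulmxA glmx_mulV mul1mx.
Qed.

(** * Stable subalgebras and their centralizers *)

(** The identity matrix is the nonzero fixed vector required by [small_space_fixed], and being fixed
    under conjugation means commuting with [G]. *)
Lemma small_stable_sub_EndG {G : {group {'GL_4['F_2]}}} {S : {set 'M['F_2]_4}} :
    simple G -> (5 %| #|G|)%N -> subalgebra S -> conj_stable G S ->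
    (#|S| <= 16)%N ->
  S \subset EndG G.
Proof.
move=> simG dvd5 [S1 cS _] sS S16.
have actS : [acts G, on S | conj_action].
  apply/subsetP=> u uG; rewrite !inE /=; apply/subsetP=> A AS.
  by rewrite inE; apply: sS.
have add a : {morph conj_action^~ a : x y / x + y}.
  by move=> x y; rewrite /= /conj_mx mulmxDr mulmxDl.
have fix1 : exists2 x, x \in 'Fix_(S | conj_action)(G)%g & x != 0.
  exists 1%:M; last exact: oner_neq0.
  rewrite inE S1; apply/afixP=> u _.
  by rewrite /= /conj_mx mulmx1 glmx_mulVx.
have := small_space_fixed simG dvd5 add cS actS fix1 S16.
move=> /subsetP fixS; apply/subsetP=> A /fixS /afixP AF.
by apply/EndGP=> u /AF; apply: conj_mx_fix.
Qed.

Lemma centralizer_conj_stable {G : {group {'GL_4['F_2]}}} {S : {set 'M['F_2]_4}} :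
  conj_stable G S -> conj_stable G (centralizer S).
Proof.
move=> sS c u /centralizerP cC uG; apply/centralizerP=> r rS.
have := cC _ (sS _ _ rS (groupVr uG)); rewrite /conj_mx invgK => e.
rewrite -[r in LHS]mulmx1 -(glmx_mulVx u) !mulmxA.
have -> : glmx u^-1%g *m c *m glmx u *m r *m glmx u^-1%g *m glmx u =
   glmx u^-1%g *m (c *m (glmx u *m r *m glmx u^-1%g)) *m glmx u.
  by rewrite !mulmxA.
by rewrite e !mulmxA glmx_mulVx mul1mx.
Qed.

(** Schur's lemma: [c |-> e *m c] is injective on the centralizer, because the kernel of [c - d] is
    a submodule, and it is everything once it contains [e]. *)
Lemma irreducible_centralizer_card {F : finFieldType} {n : nat} {R : {set 'M[F]_n}} :
  (0 < n)%N -> irreducible_algebra R -> (#|centralizer R| <= #|F| ^ n)%N.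
Proof.
case: n R => // n R _ irrR.
pose e : 'rV[F]_n.+1 := delta_mx 0 0.
rewrite -[X in (_ ^ X)%N]mul1n -card_mx.
rewrite -(card_in_imset (f := fun c => e *m c)) ?max_card // => c d cC dC /= ecd.
have cd : c - d \in centralizer R.
  by have [_ lC _] := centralizer_subalgebra R; apply: (submod_closed_sub lC).
have: submodule R [set v | v *m (c - d) == 0].
  apply/submoduleP; split; first split=> [|a u v].
  - by rewrite inE mul0mx.
  - by rewrite !inE mulmxDl -scalemxAl => /eqP-> /eqP->; rewrite scaler0 addr0.
  move=> v r; rewrite !inE -mulmxA => /eqP v0 rR.
  by move/centralizerP: cd => /(_ _ rR) <-; rewrite mulmxA v0 mul0mx.
have eK : e \in [set v | v *m (c - d) == 0] by rewrite inE mulmxBr ecd subrr.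
case/irrR=> K.
  move: eK; rewrite K inE => /eqP/matrixP/(_ 0 0).
  by rewrite !mxE !eqxx => /eqP; rewrite oner_eq0.
apply/eqP; rewrite -subr_eq0; apply/eqP/row_matrixP=> i; rewrite row0 rowE.
by have := in_setT (delta_mx 0 i : 'rV[F]_n.+1); rewrite -K inE => /eqP.
Qed.

(** * Minimal submodules and their translates *)

Lemma submoduleI {F : finFieldType} {n : nat} {R : {set 'M[F]_n}} {S T} :
  submodule R S -> submodule R T -> submodule R (S :&: T).
Proof.
move=> /submoduleP[[S0 lS] sS] /submoduleP[[T0 lT] sT].
apply/submoduleP; split; first split=> [|a u v]; first by rewrite inE S0.
  by move=> /setIP[uS uT] /setIP[vS vT]; rewrite inE lS ?lT.
by move=> v r /setIP[vS vT] rR; rewrite inE sS ?sT.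
Qed.

Definition minimal_submodule {F : finFieldType} {n : nat} (R : {set 'M[F]_n})
    (W : {set 'rV[F]_n}) : bool :=
  minset (fun S => submodule R S && (S != [set 0])) W.

Lemma minimal_submoduleI {F : finFieldType} {n : nat} {R : {set 'M[F]_n}} {S T} :
  minimal_submodule R S -> minimal_submodule R T -> S != T -> S :&: T = [set 0].
Proof.
move=> /minsetP[/andP[mS _] minS] /minsetP[/andP[mT _] minT] neST.
apply/eqP; apply: contraNT neST => nI.
have PI : submodule R (S :&: T) && (S :&: T != [set 0]) by rewrite submoduleI.
by rewrite -(minS _ PI (subsetIl _ _)) {1}(minT _ PI (subsetIr _ _)).
Qed.

(** Since [x v r = x (v r v^-1) v], stability of [R] makes translates of submodules submodules;
    minimality is carried back by [u^-1]. *)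
Lemma minimal_submodule_translate {G : {group {'GL_4['F_2]}}} {R : {set 'M['F_2]_4}}
    {W : {set 'rV['F_2]_4}} {u} :
  conj_stable G R -> u \in G -> minimal_submodule R W ->
  minimal_submodule R (setact row_action W u).
Proof.
have tr S v : conj_stable G R -> v \in G -> submodule R S && (S != [set 0]) ->
    submodule R (setact row_action S v) && (setact row_action S v != [set 0]).
  move=> sR vG /andP[/submoduleP[[S0 lS] sS] nS]; apply/andP; split.
    apply/submoduleP; split; first split=> [|a x y].
    - by apply/imsetP; exists 0; rewrite /= ?mul0mx.
    - move=> /imsetP[x' xS ->] /imsetP[y' yS ->].
      by apply/imsetP; exists (a *: x' + y'); rewrite ?lS //= mulmxDl -scalemxAl.
    move=> x r /imsetP[x' xS ->] rR; apply/imsetP.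
    exists (x' *m conj_mx r v^-1%g); first by rewrite sS // sR ?groupV.
    by rewrite /= /conj_mx invgK -!mulmxA glmx_mulVx mulmx1.
  apply: contraNneq nS => e; apply/eqP/setP=> x; rewrite inE.
  apply/idP/eqP=> [xS|-> //].
  have: row_action x v \in setact row_action S v by apply: imset_f.
  rewrite e inE /= => /eqP x0.
  by rewrite -[x]mulmx1 -(glmx_mulV v) mulmxA x0 mul0mx.
move=> sR uG /minsetP[PW minW]; apply/minsetP; split; first exact: tr.
move=> B PB BW.
have e : setact row_action B u^-1%g = W.
  apply: minW; first by apply: tr; rewrite ?groupV.
  apply/subsetP=> x /imsetP[b /(subsetP BW)/imsetP[w wW ->] ->].
  by rewrite -actM mulgV act1.
by rewrite -e -[RHS]/((row_action^*)%act ((row_action^*)%act B u^-1%g) u) actKV.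
Qed.

Lemma card_ltn_exists {T : finType} {A B : {set T}} :
  (#|B| < #|A|)%N -> exists2 x, x \in A & x \notin B.
Proof.
move=> ltBA; apply/subsetPn; apply: contraL ltBA => /subset_leq_card.
by rewrite -leqNgt.
Qed.

Lemma card_direct_sum {F : finFieldType} {n : nat} {S T : {set 'rV[F]_n}} :
  submod_closed S -> submod_closed T -> S :&: T = [set 0] ->
  #|[set x + y | x in S, y in T]| = (#|S| * #|T|)%N.
Proof.
move=> cS cT ST0; rewrite curry_imset2X card_in_imset ?cardsX //.
move=> [x y] [x' y'] /setXP[/= xS yT] /setXP[/= x'S y'T] e.
have e' : x - x' = y' - y.
  by apply/eqP; rewrite subr_eq addrAC eq_sym subr_eq addrC eq_sym e addrC.
have : x - x' \in S :&: T.
  by rewrite inE submod_closed_sub //= e' submod_closed_sub.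
rewrite ST0 inE => /eqP d0; move: e'; rewrite d0 => /esym/eqP.
by rewrite subr_eq0 => /eqP->; move/eqP: d0; rewrite subr_eq0 => /eqP->.
Qed.

(* The index-2 stabiliser of [W] would be normal. *)
Lemma simple_no_orbit2 {gT : finGroupType} {rT : finType} {G : {group gT}}
    (to : {action gT &-> rT}) (x : rT) :
  simple G -> (2 < #|G|)%N -> #|orbit to G x| != 2%N.
Proof.
move=> simG G2; rewrite card_orbit; apply/eqP=> i2.
have nH : ('C_G[x | to] <| G)%g by apply: index2_normal; rewrite ?subsetIl.
move/simpleP: simG => [_ /(_ _ nH)[] /= e]; move: i2; rewrite e.
  by rewrite indexg1 => G2'; rewrite G2' in G2.
by rewrite indexgg.
Qed.

(** * Bounds on reducible stable algebras *)

(** Each translate of [W] consists of 0 and one basis vector, so [r] is determined by the set [h r]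
    of basis vectors that it kills, leaving [2 ^ 4] choices. *)
Lemma line_submodule_card {G : {group {'GL_4['F_2]}}} {R : {set 'M['F_2]_4}}
    {W : {set 'rV['F_2]_4}} :
  mx_irreducible (GLrep G) -> conj_stable G R -> submodule R W -> #|W| = 2%N ->
  (#|R| <= 16)%N.
Proof.
move=> irrG sR /submoduleP[[W0 lW] sW] W2.
have [w wW w0] : exists2 w, w \in W & w != 0.
  have /card_ltn_exists[w wW] : (#|[set 0%R : 'rV['F_2]_4]| < #|W|)%N.
    by rewrite cards1 W2.
  by rewrite inE; exists w.
have WE : W = [set 0; w].
  apply/esym/eqP; rewrite eqEcard W2 cards2 eq_sym w0 andbT.
  by apply/subsetP=> x /set2P[]->.
have [f fG Bu] := irreducible_orbit_basis irrG w0.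
set B := \matrix_i _ in Bu.
pose h (r : 'M['F_2]_4) := [ffun i : 'I_4 => row i B *m r == 0].
have hinj : {in R &, injective h}.
  have rowB i r : r \in R -> row i B *m r = (if h r i then 0 else row i B).
    move=> rR; rewrite ffunE; case: eqP => // nz; rewrite rowK in nz *.
    have : w *m conj_mx r (f i)^-1%g \in W by rewrite sW // sR ?groupV ?fG.
    rewrite WE => /set2P[] e.
      case: nz; rewrite -[RHS](mul0mx _ (glmx (f i))) -e /conj_mx invgK -!mulmxA.
      by rewrite glmx_mulVx mulmx1.
    rewrite -[in RHS]e /conj_mx invgK -!mulmxA -[GLrep G (f i)]/(glmx (f i)).
    by rewrite glmx_mulVx mulmx1.
  move=> r s rR sR' e; apply: (can_inj (mulKmx Bu)).
  by apply/row_matrixP=> i; rewrite !row_mul !rowB // e.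
rewrite -(card_in_imset hinj); apply: leq_trans (max_card _) _.
by rewrite card_ffun card_bool card_ord.
Qed.

(** The pair of images of two independent vectors of [W] lies in [W] times [W], which has 16
    elements; it determines [r] on [W], hence [r] by faithfulness. *)
Lemma plane_faithful_card {R : {set 'M['F_2]_4}} {W : {set 'rV['F_2]_4}} :
  subalgebra R -> submodule R W -> #|W| = 4%N ->
  annihilator R (enum W) \subset [set 0] -> (#|R| <= 16)%N.
Proof.
move=> aR /submoduleP[[W0 lW] sW] W4 faithful.
have [w1 w1W w10] : exists2 w, w \in W & w != 0.
  have /card_ltn_exists[w wW] : (#|[set 0%R : 'rV['F_2]_4]| < #|W|)%N.
    by rewrite cards1 W4.
  by rewrite inE; exists w.
have [w2 w2W /norP[w20 w21]] : exists2 w, w \in W & ~~ ((w == 0) || (w == w1)).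
  have /card_ltn_exists[w wW] : (#|[set 0%R; w1]| < #|W|)%N.
    by rewrite W4 cards2; case: (_ != _).
  by rewrite !inE; exists w.
pose h (r : 'M['F_2]_4) := (w1 *m r, w2 *m r).
have hinj : {in R &, injective h}.
  move=> r s rR sR [e1 e2].
  pose K := [set w in W | w *m (r - s) == 0].
  have cK : submod_closed K.
    split=> [|a x y]; first by rewrite inE W0 mul0mx /=.
    rewrite !inE => /andP[xW /eqP x0] /andP[yW /eqP y0].
    by rewrite lW // mulmxDl -scalemxAl x0 y0 scaler0 addr0 /=.
  have KW : K = W.
    apply/eqP; rewrite eqEcard; apply/andP; split.
      by apply/subsetP=> x; rewrite inE => /andP[].
    have /subset_leq_card : [set 0; w1; w2] \subset K.
      apply/subsetP=> x; rewrite !inE -orbA => /or3P[]/eqP->.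
      - by rewrite W0 mul0mx eqxx.
      - by rewrite w1W mulmxBr e1 subrr eqxx.
      by rewrite w2W mulmxBr e2 subrr eqxx.
    (* [K] has at least 3 elements and its order is a power of 2, hence at least 4. *)
    rewrite setUC cardsU1 cards2 !inE negb_or w20 w21 eq_sym w10 /= W4.
    have [k ->] := card_submod_F2 _ cK; case: k => [|[|k]] // _.
    by rewrite !expnS mulnA leq_pmulr ?expn_gt0.
  apply/eqP; rewrite -subr_eq0 -in_set1; apply: (subsetP faithful).
  apply/annihilatorP; split; first by case: aR => _ lR _; apply: (submod_closed_sub lR).
  by move=> w; rewrite mem_enum -KW inE => /andP[_ /eqP].
rewrite -(card_in_imset hinj).
have /subset_leq_card : h @: R \subset setX W W.
  by apply/subsetP=> _ /imsetP[r rR ->]; rewrite inE !sW.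
by rewrite cardsX W4.
Qed.

Lemma irreducible_or_card_le16 {G : {group {'GL_4['F_2]}}} {R : {set 'M['F_2]_4}} :
    simple G -> (2 < #|G|)%N -> mx_irreducible (GLrep G) -> subalgebra R ->
    conj_stable G R ->
  irreducible_algebra R \/ (#|R| <= 16)%N.
Proof.
move=> simG G2 irrG aR sR.
have PT : submodule R setT && (setT != [set 0 : 'rV['F_2]_4]).
  apply/andP; split.
    apply/submoduleP; split=> [|x r _ _]; last exact: in_setT.
    by split=> [|a x y _ _]; apply: in_setT.
  apply/eqP=> /(congr1 (fun S : {set _} => #|S|)).
  by rewrite cardsT cards1 card_mx card_Fp.
have [W minW _] : {W | minimal_submodule R W & W \subset setT}.
  exact: minset_exists.
have /minsetP[/andP[mW W0] minW'] := minW.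
have [WT | WT] := eqVneq W setT.
  left=> S mS; have [->|S0] := eqVneq S [set 0]; first by left.
  by right; rewrite -WT; apply: minW'; rewrite ?mS ?WT ?subsetT.
right.
have [cW sW] := submoduleP _ _ mW.
pose tr u := setact row_action W u.
(* Otherwise [W] would be [G]-stable, against irreducibility of [G]. *)
have [u uG Wu] : exists2 u, u \in G & tr u != W.
  apply/exists_inP; rewrite -negb_forall_in; apply/negP=> /forall_inP h.
  have : {in W & G, forall v u, v *m GLrep G u \in W}.
    by move=> v u vW uG; rewrite -(eqP (h u uG)); apply/imsetP; exists v.
  by case/(irreducible_stable_set irrG cW) => /eqP; rewrite ?(negPf W0) ?(negPf WT).
have minT v : v \in G -> minimal_submodule R (tr v).
  by move=> vG; apply: (minimal_submodule_translate sR).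
have clT v : v \in G -> submod_closed (tr v).
  by move=> /minT/minsetP[/andP[/submoduleP[] //]].
have cardT v : #|tr v| = #|W| by apply: card_setact.
have dir v : v \in G -> tr v != W -> #|[set x + y | x in W, y in tr v]| = (#|W| * #|W|)%N.
  move=> vG ne; rewrite card_direct_sum ?cardT //; first exact: clT.
  by apply: (minimal_submoduleI minW (minT v vG)); rewrite eq_sym.
have cV : #|{: 'rV['F_2]_4}| = 16%N by rewrite card_mx card_Fp.
(* The sum of [W] and [tr u] is direct inside a space of 16 elements, so the square of [#|W|] is at
   most 16. *)
have W24 : #|W| = 2%N \/ #|W| = 4%N.
  have := max_card [set x + y | x in W, y in tr u]; rewrite dir // cV.
  have : #|W| != 1%N.
    apply: contra W0 => /cards1P[x Wx].
    by case: cW; rewrite Wx inE => /eqP-> _.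
  have [k ->] := card_submod_F2 _ cW; case: k => [|[|[|k]]] //; try by auto.
  by move=> _; rewrite -expnD -[16%N]/(2 ^ 4)%N leq_exp2l // !addSn !addnS.
have [W2|W4] := W24; first exact: line_submodule_card irrG sR mW W2.
have [faith|] := boolP (annihilator R (enum W) \subset [set 0]).
  exact: plane_faithful_card aR mW W4 faith.
case/subsetPn=> r0 r0I; rewrite inE => r00.
have decomp v : v \in G -> tr v != W ->
    forall z, exists2 x, x \in W & exists2 y, y \in tr v & z = x + y.
  move=> vG ne z.
  have : z \in [set x + y | x in W, y in tr v].
    have /eqP -> : [set x + y | x in W, y in tr v] == setT.
      by rewrite eqEcard subsetT cardsT dir // cV W4.
    exact: in_setT.
  by case/imset2P=> x y xW yT ->; exists x => //; exists y.
have killW w a : a \in annihilator R (enum W) -> w \in W -> w *m a = 0.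
  by move=> /annihilatorP[_ h] wW; apply: h; rewrite mem_enum.
(* As [r0] kills [W] and V = W + tr v = W + tr u, its image lies in both
   translates, hence in their intersection. *)
have two v : v \in G -> tr v != W -> tr v = tr u.
  move=> vG vW; apply/eqP; apply: contraNT r00 => ne.
  have I0 := minimal_submoduleI (minT v vG) (minT u uG) ne.
  apply/eqP/row_matrixP=> i; rewrite row0 rowE.
  have [x xW [y yT ->]] := decomp v vG vW (delta_mx 0 i).
  rewrite mulmxDl (killW x) // add0r.
  have [x' x'W [y' y'T yE]] := decomp u uG Wu y.
  apply/eqP; rewrite -in_set1 -I0 inE.
  have r0R : r0 \in R by case/annihilatorP: r0I.
  apply/andP; split.
    by have /minsetP[/andP[/submoduleP[_ h] _] _] := minT v vG; apply: h.
  rewrite yE mulmxDl (killW x') // add0r.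
  by have /minsetP[/andP[/submoduleP[_ h] _] _] := minT u uG; apply: h.
have := simple_no_orbit2 (row_action^*)%act W simG G2.
have -> : orbit (row_action^*)%act G W = [set W; tr u].
  apply/setP=> X; apply/orbitP/set2P=> [[v vG <-] | [->|->]].
  - by have [|/(two v vG)] := eqVneq (tr v) W; [left | right].
  - by exists 1%g; rewrite ?group1 ?act1.
  by exists u.
by rewrite cards2 [W == _]eq_sym Wu.
Qed.

(** * Classification of the stable subalgebras *)

Theorem theorem4p1 (G : {group {'GL_4['F_2]}})
  (hA5 : G \isog ('Alt_('I_5))%G)
  (hsimple : mx_irreducible (GLrep G))
  (hF4 : EndG_is_F4 G)
  (R : {set 'M['F_2]_4})
  (hR : F2_subalgebra R)
  (hconj : forall u : {'GL_4['F_2]}, u \in G ->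
     forall r, r \in R -> (GLval u *m r *m invmx (GLval u)) \in R) :
  R = scalarsF2 \/ R = EndG G \/ R = EndF4 G \/ R = [set: 'M['F_2]_4].
Proof.
have [simG cardG] := Alt5_simple_card _ hA5.
have dvd5 : (5 %| #|G|)%N by rewrite cardG.
have aR : subalgebra R.
  case: hR => R1 addR mulR scaleR; split=> //; apply: submod_closed_F2 => //.
  by rewrite -(scale0r 1%:M); apply: scaleR.
have sR : conj_stable G R.
  move=> r u rR uG; have := hconj _ (groupVr uG) _ rR.
  by rewrite -GL_VxE invgK.
(* Applied below both to [R] and to its centralizer. Inside [F_2[J]], either [J] lies in [S] or [S]
   is scalar: an element [a + b J] with [b] nonzero would give back [J]. *)
have small S : subalgebra S -> conj_stable G S -> (#|S| <= 16)%N ->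
    S = scalarsF2 \/ S = EndG G.
  move=> aS sS S16.
  have SE := small_stable_sub_EndG simG dvd5 aS sS S16.
  have [S1 cS _] := aS; have [S0 _] := cS.
  have scalS a : a%:M \in S by rewrite -scalemx1; apply: (submod_closed_scale cS).
  have [J [_ EJ]] := hF4.
  have [JS | JS] := boolP (J \in S).
    right; apply/eqP; rewrite eqEsubset SE EJ; apply/subsetP=> x.
    case/imset2P=> a b _ _ ->; apply: (submod_closed_add cS) => //.
    exact: (submod_closed_scale cS).
  left; apply/eqP; rewrite eqEsubset; apply/andP; split; last first.
    by apply/subsetP=> x /imsetP[a _ ->].
  apply/subsetP=> x xS; have := subsetP SE x xS; rewrite EJ.
  case/imset2P=> a b _ _ xE; apply/imsetP; exists a => //; rewrite xE.
  have [->|b0] := eqVneq b 0; first by rewrite scale0r addr0.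
  case/negP: JS; have -> : J = b^-1 *: (x - a%:M).
    by rewrite xE addrAC subrr add0r scalerA mulVf // scale1r.
  by apply: (submod_closed_scale cS); apply: (submod_closed_sub cS).
have G2 : (2 < #|G|)%N by rewrite cardG.
have [irrR | R16] := irreducible_or_card_le16 simG G2 hsimple aR sR; last first.
  by case: (small R aR sR R16) => ->; auto.
(* [R] is recovered from its centralizer, which is itself small enough to be F_2 or F_4. *)
right; right; rewrite -(bicentralizer_irreducible aR irrR).
have C16 : (#|centralizer R| <= 16)%N.
  by have := irreducible_centralizer_card (isT : 0 < 4)%N irrR; rewrite card_Fp.
have [->|->] := small _ (centralizer_subalgebra R) (centralizer_conj_stable sR) C16.
  right; apply/setP=> x; rewrite in_setT; apply/centralizerP=> B /imsetP[a _ ->].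
  by rewrite scalar_mxC.
(* [centralizer (EndG G)] is [EndF4 G] by definition. *)
by left.
Qed.
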